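(* For all $s,t\in\mathbb{N}_0=\{0,1,2,\dots\}$ and all real $a,b$ with $|a|+|b|<\tfrac12$, $$\nu_{st}(a,b)=F_4\left[\tfrac12,1;1,1;4a^2,4b^2\right]-\binom{s+t}{s}a^s b^t\,F_4\left[\tfrac12(s+t+1),\tfrac12(s+t)+1;s+1,t+1;4a^2,4b^2\right].$$
   Context: For $s,t\in\mathbb{N}_0$ and real $a,b$, the lag $(s,t)$ variogram is $$\nu_{st}(a,b):=\frac{1}{\pi^2}\int_0^\pi\int_0^\pi\frac{1-\cos(sx)\cos(ty)}{1-2a\cos x-2b\cos y}\,\mathrm{d}x\,\mathrm{d}y .$$ Appell's hypergeometric function of the fourth kind is $$F_4[\alpha,\beta;\gamma,\gamma';x,y]=\sum_{j=0}^\infty\sum_{k=0}^\infty\frac{(\alpha)_{j+k}(\beta)_{j+k}}{(\gamma)_j(\gamma')_k}\frac{x^j}{j!}\frac{y^k}{k!},\qquad \sqrt{|x|}+\sqrt{|y|}<1,$$ where $(w)_\ell:=w(w+1)\cdots(w+\ell-1)$ is the Pochhammer symbol, with $(w)_0=1$. The convention $0^0=1$ is used. *)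

(* Defs.v *)
From Stdlib Require Import Reals Factorial.
From Coquelicot Require Import Coquelicot.
Open Scope R_scope.

(* The integrand is continuous on the whole square when |a| + |b| < 1/2, so the
   double integral is rendered as the iterated Riemann integral, dx innermost. *)
Definition variogram (s t : nat) (a b : R) : R :=
  1 / PI ^ 2 *
  RInt (fun y =>
    RInt (fun x =>
      (1 - cos (INR s * x) * cos (INR t * y)) /
      (1 - 2 * a * cos x - 2 * b * cos y)) 0 PI) 0 PI.

Fixpoint pochhammer (w : R) (l : nat) : R :=
  match l with
  | O => 1
  | S l' => pochhammer w l' * (w + INR l')
  end.

(* Meaningful when neither lower parameter is a nonpositive integer and
   sqrt |x| + sqrt |y| < 1, where the double series converges absolutely; outside
   that domain the total operator Series returns an irrelevant value.  The powers
   satisfy 0 ^ 0 = 1. *)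
Definition appellF4 (alpha beta gamma gamma' x y : R) : R :=
  Series (fun j =>
    Series (fun k =>
      pochhammer alpha (j + k) * pochhammer beta (j + k) /
      (pochhammer gamma j * pochhammer gamma' k) *
      (x ^ j / INR (fact j)) * (y ^ k / INR (fact k)))).

(* Main.v *)
(* With B = 2 b cos y, expand 1 / (1 - 2 a cos x - B) geometrically in
   2 a cos x / (1 - B), integrate over x, then expand each 1 / (1 - B)^(p+1) by
   the negative binomial series and integrate over y; both exchanges follow from
   the Weierstrass M-test.  The mean of cos (s x) (2 cos x)^p over [0, PI] vanishes
   unless p = s + 2j, when it is the binomial coefficient (p choose j).  What
   remains is, term by term, the iterated series of F4 in the same order of
   summation, so no double series has to be rearranged.  The term 1 of the
   numerator is the case s = t = 0. *)

Require Import Defs.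
From Stdlib Require Import Reals.
From Coquelicot Require Import Coquelicot.
From Stdlib Require Import Factorial Lra Lia.
Open Scope R_scope.

(** * Termwise integration and thinning of series *)

Lemma is_series_tail_bound (f M : nat -> R) (l : R) (N : nat) :
  (forall n, Rabs (f n) <= M n) -> ex_series M -> is_series f l ->
  Rabs (sum_n f N - l) <= Series M - sum_n M N.
Proof.
  intros hf hM hl.
  assert (hM' : ex_series (fun k => M (S N + k)%nat)) by now apply ex_series_incr_n.
  assert (ha : ex_series (fun k => Rabs (f (S N + k)%nat))).
  { apply (ex_series_le (K := R_AbsRing) (V := R_CompleteNormedModule)) with (2 := hM').
    intros n; change (Rabs (Rabs (f (S N + n)%nat)) <= M (S N + n)%nat).
    rewrite Rabs_Rabsolu; apply hf. }
  rewrite <- (is_series_unique _ _ hl).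
  (* The cut is at [S N] because [sum_n f N] includes the index [N]. *)
  rewrite (Series_incr_n f (S N)); [ | lia | now exists l].
  rewrite (Series_incr_n M (S N)); [ | lia | exact hM].
  rewrite !sum_n_Reals; simpl Init.Nat.pred.
  replace (sum_f_R0 f N - _) with (- Series (fun k => f (S N + k)%nat)) by ring.
  rewrite Rabs_Ropp.
  replace (sum_f_R0 M N + _ - _) with (Series (fun k => M (S N + k)%nat)) by ring.
  apply Rle_trans with (1 := Series_Rabs _ ha).
  apply Series_le; [ | exact hM'].
  intros n; split; [apply Rabs_pos | apply hf].
Qed.

(** Weierstrass M-test: [is_series_tail_bound] controls the remainder by a tail of [M] alone, so the
    partial sums converge uniformly and the limit passes through the integral. The bound is asked
    for on all of R because [filterlim_RInt] uses uniform convergence of functions on the whole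
    line. *)
Lemma is_RInt_series (f : nat -> R -> R) (F : R -> R) (M I : nat -> R) (u v : R) :
  (forall n x, Rabs (f n x) <= M n) -> ex_series M ->
  (forall x, is_series (fun n => f n x) (F x)) ->
  (forall n, is_RInt (f n) u v (I n)) ->
  exists l : R, is_series I l /\ is_RInt F u v l.
Proof.
  intros hf hM hF hI.
  destruct (filterlim_RInt (V := R_CompleteNormedModule)
              (fun N x => sum_n (fun n => f n x) N) u v eventually
              eventually_filter F (sum_n I)) as [l [h1 h2]].
  - intros N; induction N as [|N IH].
    + rewrite sum_O; apply is_RInt_ext with (f 0%nat); [ | apply hI].
      intros x _; now rewrite sum_O.
    + rewrite sum_Sn.
      apply is_RInt_ext with (fun x => plus (sum_n (fun n => f n x) N) (f (S N) x)).
      * intros x _; now rewrite sum_Sn.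
      * now apply (is_RInt_plus (V := R_NormedModule)).
  - apply filterlim_locally; intros eps.
    assert (h := Series_correct _ hM).
    generalize (proj1 (filterlim_locally _ _) h eps).
    apply filter_imp; intros N hN x.
    change (Rabs (sum_n (fun n => f n x) N - F x) < eps).
    apply Rle_lt_trans with (1 := is_series_tail_bound _ M _ N (fun n => hf n x) hM (hF x)).
    change (Rabs (sum_n M N - Series M) < eps) in hN.
    rewrite Rabs_minus_sym in hN.
    now apply Rle_lt_trans with (1 := Rle_abs _).
  - now exists l; split.
Qed.

(** The partial sums of the thinned series are the partial sums of [c] at the cutoffs [s + 2 * N],
    hence a subsequence of a convergent sequence. This discards the vanishing cosine moments. *)
Lemma is_series_arith_progression (c : nat -> R) (l : R) (s : nat) :
  (forall p, (forall k, p <> (s + 2 * k)%nat) -> c p = 0) ->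
  is_series c l -> is_series (fun j => c (s + 2 * j)%nat) l.
Proof.
  intros hc hl.
  apply filterlim_ext with (fun N => sum_n c (s + 2 * N)).
  - intros N; induction N as [|N IH].
    + rewrite sum_O, Nat.mul_0_r, Nat.add_0_r.
      assert (h : forall m, (m < s)%nat -> sum_n c m = 0).
      { intros m; induction m as [|m IHm]; intros hm.
        - rewrite sum_O; apply hc; lia.
        - rewrite sum_Sn, IHm, hc by lia; apply Rplus_0_l. }
      destruct s as [|s]; [apply sum_O | ].
      rewrite sum_Sn, h by lia; apply Rplus_0_l.
    (* Two terms of [c] are added; the one at [s + 2 * N + 1] has the wrong parity and vanishes. *)
    + replace (s + 2 * S N)%nat with (S (S (s + 2 * N))) by lia.
      rewrite !sum_Sn, <- IH, (hc (S (s + 2 * N))) by lia.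
      replace (s + 2 * S N)%nat with (S (S (s + 2 * N))) by lia.
      change (sum_n c (s + 2 * N) + 0 + c (S (S (s + 2 * N))) =
              sum_n c (s + 2 * N) + c (S (S (s + 2 * N)))); ring.
  - apply (filterlim_comp _ _ _ (fun N => (s + 2 * N)%nat) (sum_n c) _ eventually);
      [ | exact hl].
    apply eventually_subseq; intros n; lia.
Qed.

(** * Binomial coefficients and the negative binomial series *)

Lemma hockey_stick (p n : nat) :
  sum_f_R0 (fun k => Binomial.C (p + k) k) n = Binomial.C (S p + n) n.
Proof.
  induction n as [|n IH].
  - simpl; now rewrite !C_n_0.
  - simpl sum_f_R0; rewrite IH.
    replace (S p + S n)%nat with (S (S p + n)) by lia.
    rewrite <- (pascal (S p + n) n) by lia.
    now replace (p + S n)%nat with (S p + n)%nat by lia.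
Qed.

Lemma binom_nonneg (n k : nat) : 0 <= Binomial.C n k.
Proof.
  unfold Binomial.C; apply Rlt_le, Rdiv_lt_0_compat.
  - apply INR_fact_lt_0.
  - apply Rmult_lt_0_compat; apply INR_fact_lt_0.
Qed.

(** Induction on [p]: one more factor [/ (1 - x)] is a Cauchy product with the geometric series,
    whose coefficients are summed by [hockey_stick]. *)
Lemma is_series_neg_binomial (p : nat) (x : R) :
  Rabs x < 1 ->
  is_series (fun q => Binomial.C (p + q) q * x ^ q) (/ (1 - x) ^ (S p)).
Proof.
  revert x; induction p as [|p IH]; intros x hx.
  - rewrite pow_1.
    apply is_series_ext with (2 := is_series_geom x hx).
    intros n; simpl; rewrite C_n_n; symmetry; apply Rmult_1_l.
  - assert (hx1 : 1 - x <> 0) by (apply Rabs_def2 in hx; lra).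
    assert (hx' : Rabs (Rabs x) < 1) by now rewrite Rabs_Rabsolu.
    replace (/ (1 - x) ^ S (S p)) with (/ (1 - x) ^ S p * / (1 - x))
      by (simpl; field; repeat split; try apply pow_nonzero; exact hx1).
    apply is_series_ext with (fun n => sum_f_R0
      (fun k => (Binomial.C (p + k) k * x ^ k) * x ^ (n - k)) n).
    + intros n.
      rewrite <- hockey_stick, Rmult_comm, scal_sum.
      apply sum_eq; intros k hk.
      rewrite Rmult_assoc, <- pow_add; do 2 f_equal; lia.
    + apply is_series_mult.
      * now apply IH.
      * now apply is_series_geom.
      (* The Cauchy product asks for absolute convergence; the coefficients being nonnegative, this
         is the induction hypothesis at [Rabs x]. *)
      * exists (/ (1 - Rabs x) ^ (S p)).
        apply is_series_ext with (2 := IH _ hx').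
        intros n; rewrite Rabs_mult, RPow_abs, (Rabs_pos_eq (Binomial.C _ _)); trivial.
        apply binom_nonneg.
      * exists (/ (1 - Rabs x)).
        apply is_series_ext with (2 := is_series_geom _ hx').
        intros n; apply RPow_abs.
Qed.

(** * Moments of the cosine *)

(* The mean of [cos (s x) (2 cos x)^n] over [0, PI]; the recurrence comes from
   [2 cos x cos (s x) = cos ((s + 1) x) + cos ((s - 1) x)]. *)
Fixpoint cos_moment (n s : nat) : R :=
  match n, s with
  | O, O => 1
  | O, S _ => 0
  | S n', O => 2 * cos_moment n' 1
  | S n', S s' => cos_moment n' (S s) + cos_moment n' s'
  end.

Lemma cos_moment_bound (n s : nat) : Rabs (cos_moment n s) <= 2 ^ n.
Proof.
  revert s; induction n as [|n IH]; intros [|s]; simpl.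
  - rewrite Rabs_R1; lra.
  - rewrite Rabs_R0; lra.
  - rewrite Rabs_mult, (Rabs_pos_eq 2) by lra.
    specialize (IH 1%nat); lra.
  - apply Rle_trans with (1 := Rabs_triang _ _).
    generalize (IH (S (S s))) (IH s); lra.
Qed.

Lemma cos_moment_zero (n s : nat) :
  (forall k, n <> (s + 2 * k)%nat) -> cos_moment n s = 0.
Proof.
  revert s; induction n as [|n IH]; intros [|s] h; simpl; trivial.
  - now elim (h 0%nat).
  - rewrite IH; [ring | intros k hk; apply (h (S k)); lia].
  - rewrite !IH; [ring | | ]; intros k hk; [apply (h k) | apply (h (S k))]; lia.
Qed.

(** Along [n = s + 2 * k] the moment recurrence is Pascal's rule. At the boundary [s = 0] the
    doubled term is also Pascal's rule, since the two middle entries of an odd row coincide. *)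
Lemma cos_moment_binom (s k : nat) :
  cos_moment (s + 2 * k) s = Binomial.C (s + 2 * k) k.
Proof.
  remember (s + 2 * k)%nat as n eqn:hn.
  revert s k hn; induction n as [|n IH]; intros [|s] k hn; try lia.
  - replace k with 0%nat by lia; simpl; now rewrite C_n_0.
  - destruct k as [|k]; [lia | ].
    simpl; rewrite (IH 1%nat k) by lia.
    rewrite <- pascal by lia.
    rewrite (pascal_step1 n k) by lia.
    replace (n - k)%nat with (S k) by lia; ring.
  - simpl; rewrite (IH s k) by lia.
    (* For [k = 0] the neighbour with index [s + 2] lies beyond the degree [n = s], so its moment
       vanishes. *)
    destruct k as [|k].
    + rewrite cos_moment_zero by (intros; lia).
      rewrite !C_n_0; ring.
    + rewrite (IH (S (S s)) k) by lia.
      now rewrite <- pascal by lia.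
Qed.

Lemma sin_INR_PI (n : nat) : sin (INR n * PI) = 0.
Proof.
  apply sin_eq_0_1; exists (Z.of_nat n); now rewrite INR_IZR_INZ.
Qed.

Lemma is_RInt_cos_moment (n s : nat) :
  is_RInt (fun x => cos (INR s * x) * (2 * cos x) ^ n) 0 PI (PI * cos_moment n s).
Proof.
  revert s; induction n as [|n IH]; intros [|s].
  - apply is_RInt_ext with (fun _ => 1).
    + intros x _; simpl; rewrite Rmult_0_l, cos_0; symmetry; apply Rmult_1_l.
    + replace (PI * cos_moment 0 0) with (scal (PI - 0) 1)
        by (unfold scal; simpl; unfold mult; simpl; ring).
      apply (is_RInt_const (V := R_NormedModule)).
  - assert (hs : INR (S s) <> 0) by (apply not_0_INR; lia).
    (* The antiderivative [sin (c * x) / c] vanishes at both ends because [c] is an integer. *)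
    replace (PI * cos_moment 0 (S s)) with
      (minus (sin (INR (S s) * PI) / INR (S s)) (sin (INR (S s) * 0) / INR (S s))).
    2:{ rewrite sin_INR_PI, Rmult_0_r, sin_0.
        change (@eq R (0 / INR (S s) - 0 / INR (S s)) (PI * 0)); field; exact hs. }
    revert hs; generalize (INR (S s)); intros c hc.
    apply (is_RInt_derive (V := R_CompleteNormedModule) (fun x => sin (c * x) / c)).
    + intros x _; auto_derive; trivial; rewrite pow_O; field; exact hc.
    + intros x _; apply (ex_derive_continuous (V := R_NormedModule)); auto_derive; trivial.
  - replace (PI * cos_moment (S n) 0) with (scal 2 (PI * cos_moment n 1))
      by (unfold scal; simpl; unfold mult; simpl; ring).
    apply is_RInt_ext with (2 := is_RInt_scal _ _ _ 2 _ (IH 1%nat)).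
    intros x _; unfold scal; simpl; unfold mult; simpl.
    rewrite Rmult_0_l, cos_0, !Rmult_1_l; ring.
  - replace (PI * cos_moment (S n) (S s)) with
      (plus (PI * cos_moment n (S (S s))) (PI * cos_moment n s))
      by (unfold plus; simpl; ring).
    apply is_RInt_ext with (2 := is_RInt_plus _ _ _ _ _ _ (IH (S (S s))) (IH s)).
    intros x _; change plus with Rplus; cbv beta.
    replace (INR (S (S s)) * x) with (INR (S s) * x + x) by (rewrite (S_INR (S s)); ring).
    replace (INR s * x) with (INR (S s) * x - x) by (rewrite (S_INR s); ring).
    rewrite cos_plus, cos_minus; simpl; ring.
Qed.

(** * Series expansions of the inner and outer integrals *)

Lemma Rabs_cos_le_1 (x : R) : Rabs (cos x) <= 1.
Proof. apply Rabs_le, COS_bound. Qed.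

Lemma Rabs_2cos_le (u x : R) : Rabs (2 * u * cos x) <= 2 * Rabs u.
Proof.
  rewrite !Rabs_mult, (Rabs_pos_eq 2) by lra.
  generalize (Rabs_cos_le_1 x) (Rabs_pos u); intros; nra.
Qed.

(** Termwise integration of the negative binomial series in [2 * b * cos y]; the same series at
    [2 * Rabs b] is the majorant. *)
Lemma is_RInt_cos_neg_power (p t : nat) (b : R) :
  2 * Rabs b < 1 ->
  exists J : R,
    is_series (fun q => Binomial.C (p + q) q * b ^ q * cos_moment q t) J /\
    is_RInt (fun y => cos (INR t * y) / (1 - 2 * b * cos y) ^ S p) 0 PI (PI * J).
Proof.
  intros hb.
  destruct (is_RInt_series
    (fun q y => Binomial.C (p + q) q * b ^ q * (cos (INR t * y) * (2 * cos y) ^ q))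
    (fun y => cos (INR t * y) / (1 - 2 * b * cos y) ^ S p)
    (fun q => Binomial.C (p + q) q * (2 * Rabs b) ^ q)
    (fun q => Binomial.C (p + q) q * b ^ q * (PI * cos_moment q t)) 0 PI)
    as [l [h1 h2]].
  - intros q y.
    replace (Binomial.C (p + q) q * b ^ q * (cos (INR t * y) * (2 * cos y) ^ q))
      with (Binomial.C (p + q) q * (cos (INR t * y) * (2 * b * cos y) ^ q))
      by (rewrite !Rpow_mult_distr; ring).
    rewrite Rabs_mult, (Rabs_pos_eq (Binomial.C _ _)) by apply binom_nonneg.
    apply Rmult_le_compat_l; [apply binom_nonneg | ].
    rewrite Rabs_mult, <- RPow_abs, <- (Rmult_1_l ((2 * Rabs b) ^ q)).
    apply Rmult_le_compat; [apply Rabs_pos | apply pow_le, Rabs_pos | apply Rabs_cos_le_1 | ].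
    apply pow_incr; split; [apply Rabs_pos | apply Rabs_2cos_le].
  - exists (/ (1 - 2 * Rabs b) ^ S p); apply is_series_neg_binomial.
    rewrite Rabs_pos_eq; generalize (Rabs_pos b); lra.
  - intros y.
    assert (hB := Rle_lt_trans _ _ _ (Rabs_2cos_le b y) hb).
    apply is_series_ext with
      (2 := is_series_scal_l (cos (INR t * y)) _ _ (is_series_neg_binomial p _ hB)).
    intros q; unfold scal; simpl; unfold mult; simpl.
    rewrite !Rpow_mult_distr; ring.
  - intros q; apply (is_RInt_scal (V := R_NormedModule)), is_RInt_cos_moment.
  - exists (l / PI); split.
    + replace (l / PI) with (scal (/ PI) l) by apply Rmult_comm.
      apply is_series_ext with (2 := is_series_scal_l (/ PI) _ _ h1).
      intros q; unfold scal; simpl; unfold mult; simpl; field; apply PI_neq0.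
    + now replace (PI * (l / PI)) with l by (field; apply PI_neq0).
Qed.

(** [B] stands for [2 * b * cos y], constant in [x]. The hypothesis makes the geometric ratio at
    most [2 * Rabs a / (1 - B) < 1] in absolute value, uniformly in [x]. *)
Lemma is_RInt_geometric (s : nat) (a B : R) :
  2 * Rabs a + Rabs B < 1 ->
  exists J : R,
    is_series (fun p => a ^ p * cos_moment p s / (1 - B) ^ S p) J /\
    is_RInt (fun x => cos (INR s * x) / (1 - 2 * a * cos x - B)) 0 PI (PI * J).
Proof.
  intros hab.
  assert (hB : 0 < 1 - B) by (generalize (Rle_abs B) (Rabs_pos a); lra).
  assert (hr : 2 * Rabs a / (1 - B) < 1).
  { apply Rmult_lt_reg_r with (1 - B); [exact hB | ].
    unfold Rdiv; rewrite Rmult_assoc, Rinv_l by lra.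
    generalize (Rle_abs B); lra. }
  assert (hi : 0 < / (1 - B)) by now apply Rinv_0_lt_compat.
  destruct (is_RInt_series
    (fun p x => a ^ p / (1 - B) ^ S p * (cos (INR s * x) * (2 * cos x) ^ p))
    (fun x => cos (INR s * x) / (1 - 2 * a * cos x - B))
    (fun p => / (1 - B) * (2 * Rabs a / (1 - B)) ^ p)
    (fun p => a ^ p / (1 - B) ^ S p * (PI * cos_moment p s)) 0 PI)
    as [l [h1 h2]].
  - intros p x.
    replace (a ^ p / (1 - B) ^ S p * (cos (INR s * x) * (2 * cos x) ^ p))
      with (/ (1 - B) * (cos (INR s * x) * (2 * a * cos x / (1 - B)) ^ p)).
    2:{ unfold Rdiv; rewrite !Rpow_mult_distr, pow_inv; simpl; field.
        split; [apply pow_nonzero | ]; lra. }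
    rewrite Rabs_mult, (Rabs_pos_eq (/ (1 - B))) by lra.
    apply Rmult_le_compat_l; [lra | ].
    rewrite Rabs_mult, <- RPow_abs, <- (Rmult_1_l ((2 * Rabs a / (1 - B)) ^ p)).
    apply Rmult_le_compat; [apply Rabs_pos | apply pow_le, Rabs_pos | apply Rabs_cos_le_1 | ].
    apply pow_incr; split; [apply Rabs_pos | ].
    unfold Rdiv; rewrite Rabs_mult, (Rabs_pos_eq (/ (1 - B))) by lra.
    apply Rmult_le_compat_r; [lra | apply Rabs_2cos_le].
  - exists (scal (/ (1 - B)) (/ (1 - 2 * Rabs a / (1 - B)))).
    apply is_series_scal_l with (a := fun p => (2 * Rabs a / (1 - B)) ^ p).
    apply is_series_geom.
    rewrite Rabs_pos_eq; [exact hr | ].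
    apply Rmult_le_pos; [generalize (Rabs_pos a) | ]; lra.
  - intros x.
    assert (hx : Rabs (2 * a * cos x / (1 - B)) < 1).
    { apply Rle_lt_trans with (2 := hr).
      unfold Rdiv; rewrite Rabs_mult, (Rabs_pos_eq (/ (1 - B))) by lra.
      apply Rmult_le_compat_r; [lra | apply Rabs_2cos_le]. }
    assert (hD : 1 - 2 * a * cos x - B <> 0).
    { generalize (Rle_abs (2 * a * cos x)) (Rabs_2cos_le a x) (Rle_abs B); lra. }
    replace (cos (INR s * x) / (1 - 2 * a * cos x - B)) with
      (scal (cos (INR s * x) / (1 - B)) (/ (1 - 2 * a * cos x / (1 - B)))).
    2:{ unfold scal; simpl; unfold mult; simpl; field; repeat split; lra. }
    apply is_series_ext with (2 := is_series_scal_l _ _ _ (is_series_geom _ hx)).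
    intros p; unfold scal; simpl; unfold mult; simpl.
    unfold Rdiv; rewrite !Rpow_mult_distr, pow_inv; field.
    split; [apply pow_nonzero | ]; lra.
  - intros p; apply (is_RInt_scal (V := R_NormedModule)), is_RInt_cos_moment.
  - exists (l / PI); split.
    + replace (l / PI) with (scal (/ PI) l) by apply Rmult_comm.
      apply is_series_ext with (2 := is_series_scal_l (/ PI) _ _ h1).
      intros p; unfold scal; simpl; unfold mult; simpl; field.
      repeat split; try apply pow_nonzero; try apply PI_neq0; lra.
    + now replace (PI * (l / PI)) with l by (field; apply PI_neq0).
Qed.

(** [RInt] is total, so splitting the inner integral by linearity requires integrability at each
    [y]. *)
Lemma ex_RInt_cos_cos (s t : nat) (a b y : R) :
  Rabs a + Rabs b < 1 / 2 ->
  ex_RInt (fun x => cos (INR s * x) * cos (INR t * y) /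
    (1 - 2 * a * cos x - 2 * b * cos y)) 0 PI.
Proof.
  intros hab.
  destruct (is_RInt_geometric s a (2 * b * cos y)) as [J [_ h]].
  - generalize (Rabs_2cos_le b y); lra.
  - exists (scal (cos (INR t * y)) (PI * J)).
    apply is_RInt_ext with (2 := is_RInt_scal _ _ _ (cos (INR t * y)) _ h).
    intros x _; unfold scal; simpl; unfold mult; simpl; unfold Rdiv; ring.
Qed.

(** The expansion of [is_RInt_geometric] is integrated termwise over [y]. Since
    [1 - 2 * b * cos y >= 1 - 2 * Rabs b] and moments are at most [2 ^ p] in absolute value, a
    geometric majorant of ratio [2 * Rabs a / (1 - 2 * Rabs b)] works; this ratio is below 1 exactly
    because [Rabs a + Rabs b < 1 / 2]. *)
Lemma is_RInt_cos_cos (s t : nat) (a b : R) :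
  Rabs a + Rabs b < 1 / 2 ->
  exists J : R,
    is_series (fun p => a ^ p * cos_moment p s *
      Series (fun q => Binomial.C (p + q) q * b ^ q * cos_moment q t)) J /\
    is_RInt (fun y =>
      RInt (fun x => cos (INR s * x) * cos (INR t * y) /
        (1 - 2 * a * cos x - 2 * b * cos y)) 0 PI) 0 PI (PI ^ 2 * J).
Proof.
  intros hab.
  assert (hb : 0 < 1 - 2 * Rabs b) by (generalize (Rabs_pos a); lra).
  assert (hr : 0 <= 2 * Rabs a / (1 - 2 * Rabs b) < 1).
  { split.
    - apply Rle_div_r; [lra | ]; generalize (Rabs_pos a); lra.
    - apply Rlt_div_l; lra. }
  destruct (is_RInt_series
    (fun p y => PI * (a ^ p * cos_moment p s) *
      (cos (INR t * y) / (1 - 2 * b * cos y) ^ S p))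
    (fun y => RInt (fun x => cos (INR s * x) * cos (INR t * y) /
        (1 - 2 * a * cos x - 2 * b * cos y)) 0 PI)
    (fun p => PI / (1 - 2 * Rabs b) * (2 * Rabs a / (1 - 2 * Rabs b)) ^ p)
    (fun p => PI * (a ^ p * cos_moment p s) *
      (PI * Series (fun q => Binomial.C (p + q) q * b ^ q * cos_moment q t))) 0 PI)
    as [l [h1 h2]].
  - intros p y.
    assert (hy : 1 - 2 * Rabs b <= 1 - 2 * b * cos y)
      by (generalize (Rle_abs (2 * b * cos y)) (Rabs_2cos_le b y); lra).
    assert (hP := PI_RGT_0).
    replace (PI / (1 - 2 * Rabs b) * (2 * Rabs a / (1 - 2 * Rabs b)) ^ p) with
      (PI * (Rabs a ^ p * 2 ^ p) * (1 / (1 - 2 * Rabs b) ^ S p)).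
    2:{ unfold Rdiv; rewrite !Rpow_mult_distr, pow_inv; simpl; field.
        repeat split; try apply pow_nonzero; lra. }
    rewrite Rabs_mult, Rabs_mult, (Rabs_pos_eq PI), Rabs_mult by lra.
    apply Rmult_le_compat; try apply Rabs_pos.
    + apply Rmult_le_pos; [lra | apply Rmult_le_pos; apply Rabs_pos].
    + apply Rmult_le_compat_l; [lra | ].
      rewrite RPow_abs.
      apply Rmult_le_compat_l; [apply Rabs_pos | apply cos_moment_bound].
    + unfold Rdiv; rewrite Rabs_mult.
      assert (hp : 0 < (1 - 2 * Rabs b) ^ S p) by now apply pow_lt.
      assert (hq : (1 - 2 * Rabs b) ^ S p <= (1 - 2 * b * cos y) ^ S p)
        by (apply pow_incr; lra).
      rewrite (Rabs_pos_eq (/ _)) by (apply Rlt_le, Rinv_0_lt_compat; lra).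
      apply Rmult_le_compat; [apply Rabs_pos | | apply Rabs_cos_le_1 | ].
      * apply Rlt_le, Rinv_0_lt_compat; lra.
      * now apply Rinv_le_contravar.
  - exists (scal (PI / (1 - 2 * Rabs b)) (/ (1 - 2 * Rabs a / (1 - 2 * Rabs b)))).
    apply is_series_scal_l with (a := fun p => (2 * Rabs a / (1 - 2 * Rabs b)) ^ p).
    apply is_series_geom; now rewrite Rabs_pos_eq.
  - intros y.
    destruct (is_RInt_geometric s a (2 * b * cos y)) as [J [hJ h]].
    { generalize (Rabs_2cos_le b y); lra. }
    replace (RInt _ 0 PI) with (scal (PI * cos (INR t * y)) J).
    + apply is_series_ext with (2 := is_series_scal_l _ _ _ hJ).
      intros p; unfold scal; simpl; unfold mult; simpl; unfold Rdiv; ring.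
    + symmetry; apply is_RInt_unique.
      replace (scal (PI * cos (INR t * y)) J) with (scal (cos (INR t * y)) (PI * J))
        by (unfold scal; simpl; unfold mult; simpl; ring).
      apply is_RInt_ext with (2 := is_RInt_scal _ _ _ (cos (INR t * y)) _ h).
      intros x _; unfold scal; simpl; unfold mult; simpl; unfold Rdiv; ring.
  - intros p.
    destruct (is_RInt_cos_neg_power p t b) as [J [hJ h]]; [lra | ].
    rewrite (is_series_unique _ _ hJ).
    now apply (is_RInt_scal (V := R_NormedModule)).
  - exists (l / PI ^ 2).
    assert (hP := PI_neq0).
    split.
    + replace (l / PI ^ 2) with (scal (/ PI ^ 2) l) by apply Rmult_comm.
      apply is_series_ext with (2 := is_series_scal_l (/ PI ^ 2) _ _ h1).
      intros p; unfold scal; simpl; unfold mult; simpl; field; exact hP.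
    + now replace (PI ^ 2 * (l / PI ^ 2)) with l by (field; exact hP).
Qed.

(** * Identification with Appell's function *)

Lemma pochhammer_succ (m j : nat) :
  pochhammer (INR m + 1) j = INR (fact (m + j)) / INR (fact m).
Proof.
  assert (hm := INR_fact_neq_0 m).
  induction j as [|j IH]; simpl pochhammer.
  - rewrite Nat.add_0_r; field; exact hm.
  - rewrite IH, Nat.add_succ_r, fact_simpl, mult_INR, S_INR, plus_INR; field; exact hm.
Qed.

(** Raising [l] by one multiplies the left side by [4 * ((N + 1) / 2 + l) * (N / 2 + 1 + l)], which
    is [(N + 2l + 1) * (N + 2l + 2)], the next two factors of the factorial. *)
Lemma pochhammer_duplication (N l : nat) :
  pochhammer (1 / 2 * (INR N + 1)) l * pochhammer (1 / 2 * INR N + 1) l * 4 ^ l =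
  INR (fact (N + 2 * l)) / INR (fact N).
Proof.
  assert (hN := INR_fact_neq_0 N).
  induction l as [|l IH]; simpl pochhammer.
  - rewrite Nat.mul_0_r, Nat.add_0_r; simpl; field; exact hN.
  - replace (N + 2 * S l)%nat with (S (S (N + 2 * l))) by lia.
    rewrite !fact_simpl, !mult_INR, !S_INR, plus_INR, mult_INR; simpl (INR 2).
    transitivity ((pochhammer (1 / 2 * (INR N + 1)) l * pochhammer (1 / 2 * INR N + 1) l * 4 ^ l) *
      ((INR N + 2 * INR l + 1 + 1) * (INR N + 2 * INR l + 1))).
    + simpl; field.
    + rewrite IH; field; exact hN.
Qed.

(** Only [p = s + 2j] and [q = t + 2k] survive. There the product of the three binomial coefficients
    collapses to [(s + t + 2j + 2k)! / (j! (s + j)! k! (t + k)!)], and duplication with [N = s + t]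
    gives the same for the Appell term, the powers of 4 coming from [4 * a ^ 2] and [4 * b ^ 2]. *)
Lemma appellF4_cos_moment (s t : nat) (a b : R) :
  Rabs a + Rabs b < 1 / 2 ->
  is_series (fun p => a ^ p * cos_moment p s *
      Series (fun q => Binomial.C (p + q) q * b ^ q * cos_moment q t))
    (Binomial.C (s + t) s * a ^ s * b ^ t *
    appellF4 (1 / 2 * (INR s + INR t + 1)) (1 / 2 * (INR s + INR t) + 1)
      (INR s + 1) (INR t + 1) (4 * a ^ 2) (4 * b ^ 2)).
Proof.
  intros hab.
  (* Convergence of the outer series is a by-product of the integration; only then may it be
     thinned. The inner series is handled likewise below. *)
  destruct (is_RInt_cos_cos s t a b hab) as [J [hJ _]].
  replace (Binomial.C (s + t) s * a ^ s * b ^ t * appellF4 _ _ _ _ _ _) with J; trivial.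
  apply (is_series_arith_progression _ _ s) in hJ.
  2:{ intros p hp; rewrite cos_moment_zero by exact hp; ring. }
  rewrite <- (is_series_unique _ _ hJ).
  unfold appellF4; rewrite <- Series_scal_l.
  apply Series_ext; intros j.
  destruct (is_RInt_cos_neg_power (s + 2 * j) t b) as [K [hK _]].
  { generalize (Rabs_pos a); lra. }
  rewrite (is_series_unique _ _ hK).
  apply (is_series_arith_progression _ _ t) in hK.
  2:{ intros q hq; rewrite cos_moment_zero by exact hq; ring. }
  rewrite <- (is_series_unique _ _ hK), <- !Series_scal_l.
  apply Series_ext; intros k.
  assert (hd := pochhammer_duplication (s + t) (j + k)).
  rewrite plus_INR in hd.
  rewrite !pochhammer_succ, !cos_moment_binom.
  set (P := pochhammer _ _ * pochhammer _ _) in *.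
  replace P with (INR (fact (s + t + 2 * (j + k))) / INR (fact (s + t)) / 4 ^ (j + k)).
  2:{ rewrite <- hd; field; apply pow_nonzero; lra. }
  unfold Binomial.C.
  replace (s + 2 * j + (t + 2 * k))%nat with (s + t + 2 * (j + k))%nat by lia.
  replace (s + t + 2 * (j + k) - (t + 2 * k))%nat with (s + 2 * j)%nat by lia.
  replace (s + 2 * j - j)%nat with (s + j)%nat by lia.
  replace (t + 2 * k - k)%nat with (t + k)%nat by lia.
  replace (s + t - s)%nat with t by lia.
  rewrite !Rpow_mult_distr, !pow_add, !pow_mult.
  field; repeat split; try apply pow_nonzero; try apply INR_fact_neq_0; lra.
Qed.

(* Stdlib reals with Coquelicot; Binomial.C is qualified because Coquelicot's C denotes the complex numbers. *)
Theorem theorem1 (s t : nat) (a b : R) (hab : Rabs a + Rabs b < 1 / 2) :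
  variogram s t a b =
    appellF4 (1 / 2) 1 1 1 (4 * a ^ 2) (4 * b ^ 2) -
    Binomial.C (s + t) s * a ^ s * b ^ t *
    appellF4 (1 / 2 * (INR s + INR t + 1)) (1 / 2 * (INR s + INR t) + 1)
      (INR s + 1) (INR t + 1) (4 * a ^ 2) (4 * b ^ 2).
Proof.
  destruct (is_RInt_cos_cos 0 0 a b hab) as [J0 [hJ0 h0]].
  destruct (is_RInt_cos_cos s t a b hab) as [J [hJ h]].
  assert (e0 := is_series_unique _ _ hJ0).
  rewrite (is_series_unique _ _ (appellF4_cos_moment 0 0 a b hab)) in e0.
  assert (e := is_series_unique _ _ hJ).
  rewrite (is_series_unique _ _ (appellF4_cos_moment s t a b hab)) in e.
  rewrite e.
  (* At [s = t = 0] the prefactor is 1 and the parameters reduce to [1 / 2, 1; 1, 1]. *)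
  replace (appellF4 (1 / 2) 1 1 1 (4 * a ^ 2) (4 * b ^ 2)) with J0.
  2:{ rewrite <- e0; simpl (0 + 0)%nat; rewrite C_n_0; simpl (INR 0); simpl (_ ^ 0).
      rewrite !Rplus_0_l, Rmult_0_r, Rplus_0_l, !Rmult_1_r, !Rmult_1_l; reflexivity. }
  unfold variogram.
  rewrite (is_RInt_unique _ _ _ (minus (PI ^ 2 * J0) (PI ^ 2 * J))).
  - unfold minus, plus, opp; simpl; field; apply PI_neq0.
  - apply is_RInt_ext with (2 := is_RInt_minus _ _ _ _ _ _ h0 h).
    intros y _.
    rewrite <- (RInt_minus (V := R_CompleteNormedModule))
      by now apply ex_RInt_cos_cos.
    apply RInt_ext; intros x _.
    unfold minus, plus, opp; simpl; rewrite !Rmult_0_l, cos_0; unfold Rdiv; ring.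
Qed.
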